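(* Let $P,Q\in\mathcal{L}(n)$ with $P\geq Q$. Then $P$ covers $Q$ in $\mathcal{L}(n)$ if and only if $|P|=|Q|+1$.
   Context: A finite atomic lattice is a finite lattice in which every element other than the minimum $\hat 0$ is a join of atoms, an atom being an element covering $\hat 0$. $\mathcal{L}(n)$ is the set of all finite atomic lattices with $n$ ordered atoms (up to isomorphism respecting the ordering of the atoms), partially ordered by: $Q\leq P$ if and only if there is a join-preserving map $P\to Q$ which is a bijection on atoms (respecting the ordering). Equivalently, a finite atomic lattice with $n$ ordered atoms is identified with a set $\mathcal{S}$ of subsets of $\{1,\dots,n\}$ that is closed under intersections and contains $\emptyset$, $\{1,\dots,n\}$ and all singletons $\{i\}$ (ordered by inclusion), and $Q\le P$ if and only if $\mathcal{S}_Q\subseteq\mathcal{S}_P$. $|P|$ is the number of elements of $P$. *)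

(* Defs.v *)
From HB Require Import structures.
From mathcomp Require Import all_boot all_order.
Set Implicit Arguments.
Unset Strict Implicit.
Unset Printing Implicit Defensive.
Import Order.TTheory.
Local Open Scope order_scope.

(* [y] covers [x] for the strict order [lt]. *)
Definition covers (T : Type) (lt : T -> T -> Prop) (y x : T) : Prop :=
  lt x y /\ ~ exists z : T, lt x z /\ lt z y.

Definition is_atom d (L : finTBLatticeType d) (x : L) : Prop :=
  covers (fun y z : L => y < z) x \bot.

(* A finite atomic lattice with [n] ordered atoms: the order on the atoms is  *)
(* recorded as a bijection [fal_atom] from ['I_n] onto the set of atoms.      *)
(* [finTBLatticeType] is exactly "nonempty finite lattice"; it does not       *)
(* require [\bot != \top].                                                    *)
Record finAtomicLattice (n : nat) := FinAtomicLattice {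
  fal_disp : Order.disp_t;
  fal_sort :> finTBLatticeType fal_disp;
  fal_atom : 'I_n -> fal_sort;
  fal_atom_inj : injective fal_atom;
  fal_atomP : forall x : fal_sort, is_atom x <-> exists i, fal_atom i = x;
  fal_atomic : forall x : fal_sort, x != \bot ->
    exists2 A : {set fal_sort},
      (forall a, a \in A -> is_atom a) & x = \join_(a in A) a }.

(* The elements of L(n) are the isomorphism classes of [finAtomicLattice n].  *)
(* We work with representatives, so [fal_iso] is equality in L(n).            *)
Definition fal_iso n (Q P : finAtomicLattice n) : Prop :=
  exists f : P -> Q,
    [/\ bijective f, {mono f : x y / x <= y}
      & forall i, f (fal_atom P i) = fal_atom Q i].

(* A map that sends the [i]-th atom to the [i]-th atom is precisely a map     *)
(* inducing an order-respecting bijection on atoms.                           *)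
Definition fal_le n (Q P : finAtomicLattice n) : Prop :=
  exists f : P -> Q,
    Order.join_morphism f /\ forall i, f (fal_atom P i) = fal_atom Q i.

Definition fal_lt n (Q P : finAtomicLattice n) : Prop :=
  fal_le Q P /\ ~ fal_iso Q P.

(* Main.v *)
Require Import Defs.
From HB Require Import structures.
From mathcomp Require Import all_boot all_order.

(** Send an element [x] of an atomic lattice to the set of the indices of the
    atoms below it. Atomicity says exactly that this map is an order embedding
    into the subsets of ['I_n], so a lattice is known up to isomorphism from its
    image, a family of sets that contains the empty set, the whole set and the
    singletons, and is stable under intersection ([closure_system]). Every such
    family arises from a lattice ([realization]), [fal_le] becomes inclusion of
    families ([fal_leE]), and [fal_iso] becomes equality ([fal_isoE]). So the
    theorem is about finite families of sets ordered by inclusion, the number of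
    elements of a lattice being the cardinal of its family.

    If the cardinals differ by one, no family fits strictly in between. For the
    converse, let [S] be strictly included in [T], and let [A] be of minimal
    cardinal in the difference. The intersection of [A] with a member of [S] is
    in [T]; it is either [A] or a smaller set, which then lies in [S] by
    minimality. So [S] with [A] added is again a closure system
    ([closure_system_setU1]), and when [T] covers [S] it must be all of [T]. *)

Set Implicit Arguments.
Unset Strict Implicit.
Unset Printing Implicit Defensive.
Import Order.TTheory.
Local Open Scope order_scope.

(** * Families of sets closed under intersection *)

Definition closure_system n (S : {set {set 'I_n}}) : Prop :=
  [/\ set0 \in S, setT \in S, forall i, [set i] \in S
    & {in S &, forall A B, A :&: B \in S}].

(** A member of the difference of minimal cardinal meets every member of [S]
    in itself or in a strictly smaller member of [T], which minimality puts
    in [S]. *)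
Lemma closure_system_setU1 n (S T : {set {set 'I_n}}) :
    closure_system S -> closure_system T -> S \proper T ->
  exists A, [/\ A \in T, A \notin S & closure_system (A |: S)].
Proof.
move=> [S0 S1 Si SI] [_ _ _ TI] /properP[sST [A0 A0T A0S]].
have A0TS : A0 \in T :\: S by rewrite inE A0S.
case: (arg_minnP (fun A : {set 'I_n} => #|A|) A0TS) => A /setDP[AT AS] minA.
have capA B : B \in S -> A :&: B \in A |: S.
  move=> BS; rewrite !inE; case: eqVneq => //= neqA.
  apply/contraT => ABS; have /minA : A :&: B \in T :\: S.
    by rewrite inE ABS TI ?(subsetP sST _ BS).
  by rewrite leqNgt proper_card // properEneq neqA subsetIl.
exists A; split=> //; split; rewrite ?inE ?S0 ?S1 ?orbT //.
  by move=> i; rewrite inE Si orbT.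
move=> B C /setU1P[->|BS] /setU1P[->|CS].
- by rewrite setIid setU11.
- exact: capA.
- by rewrite setIC capA.
- by rewrite in_setU1 SI ?orbT.
Qed.

(** * The lattice of a closure system *)

(** The closure axioms are a parameter of the carrier so that the lattice
    instances below can be inferred from the type alone. *)
Record member n (S : {set {set 'I_n}}) (clS : closure_system S) :=
  Member { member_set : {set 'I_n}; _ : member_set \in S }.

Section Realization.
Variables (n : nat) (S : {set {set 'I_n}}) (clS : closure_system S).
Local Notation L := (member clS).
Implicit Types x y z : L.

HB.instance Definition _ := [isSub of L for @member_set n S clS].
HB.instance Definition _ := [Finite of L by <:].

Definition member_le x y := val x \subset val y.

Fact member_le_refl : reflexive member_le.
Proof. by move=> x; apply: subxx. Qed.

Fact member_le_anti : antisymmetric member_le.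
Proof. by move=> x y; rewrite -eqEsubset => /eqP/val_inj. Qed.

Fact member_le_trans : transitive member_le.
Proof. by move=> y x z; apply: subset_trans. Qed.

HB.instance Definition _ := Order.Le_isPOrder.Build Order.SetSubsetOrder.subset_display L
  member_le_refl member_le_anti member_le_trans.

Fact member_meet_subproof x y : val x :&: val y \in S.
Proof. by case: clS => _ _ _; apply; apply: valP. Qed.

Definition member_meet x y : L := Member clS (member_meet_subproof x y).

Fact member_join_subproof x y :
  \bigcap_(C in S | val x :|: val y \subset C) C \in S.
Proof.
case: clS => _ ST _ SI.
by apply: (big_ind (fun C => C \in S)) => [||C /andP[]].
Qed.

Definition member_join x y : L := Member clS (member_join_subproof x y).

Fact member_lexI x y z : (x <= member_meet y z) = (x <= y) && (x <= z).
Proof. exact: subsetI. Qed.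

Fact member_leUx x y z : (member_join x y <= z) = (x <= z) && (y <= z).
Proof.
rewrite -[RHS]subUset; apply/idP/idP => [|xyz].
  by apply: subset_trans; apply/bigcapsP => C /andP[].
by apply: bigcap_inf; rewrite (valP z).
Qed.

HB.instance Definition _ := Order.POrder_MeetJoin_isLattice.Build
  Order.SetSubsetOrder.subset_display L member_lexI member_leUx.

Fact member_bot_subproof : set0 \in S. Proof. by case: clS. Qed.
Fact member_top_subproof : setT \in S. Proof. by case: clS. Qed.
Fact member_atom_subproof i : [set i] \in S. Proof. by case: clS. Qed.

Fact member_le0x x : (Member clS member_bot_subproof : L) <= x.
Proof. exact: sub0set. Qed.

Fact member_lex1 x : x <= (Member clS member_top_subproof : L).
Proof. exact: subsetT. Qed.

HB.instance Definition _ :=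
  Order.hasBottom.Build Order.SetSubsetOrder.subset_display L member_le0x.
HB.instance Definition _ :=
  Order.hasTop.Build Order.SetSubsetOrder.subset_display L member_lex1.

Definition member_atom i : L := Member clS (member_atom_subproof i).

Lemma member_atom_le i x : (member_atom i <= x) = (i \in val x).
Proof. exact: sub1set. Qed.

Lemma member_atom_inj : injective member_atom.
Proof. by move=> i j /(congr1 val) /set1_inj. Qed.

Lemma member_neq0 x : x != \bot -> exists i, member_atom i <= x.
Proof.
rewrite -val_eqE => /set0Pn[i ix].
by exists i; rewrite member_atom_le.
Qed.

Lemma member_atom_neq0 i : member_atom i != \bot.
Proof. by rewrite -val_eqE; apply/set0Pn; exists i; apply: set11. Qed.

Lemma member_atomP x : is_atom x <-> exists i, member_atom i = x.
Proof.
split=> [[x_gt0 min_x]|[i <-]].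
  have [|i lix] := @member_neq0 x; first by rewrite -lt0x.
  exists i; apply/eqP/contraT => neq_ix; case: min_x.
  by exists (member_atom i); rewrite lt0x member_atom_neq0 lt_neqAle neq_ix.
split=> [|[z []]]; first by rewrite lt0x member_atom_neq0.
rewrite lt0x => /member_neq0[j ljz] /(le_lt_trans ljz).
rewrite lt_neqAle member_atom_le => /andP[/eqP neq_ji /set1P eq_ji].
by rewrite eq_ji in neq_ji.
Qed.

Lemma member_atomic x : x != \bot ->
  exists2 A : {set L}, (forall a, a \in A -> is_atom a) & x = \join_(a in A) a.
Proof.
move=> _; exists (member_atom @: val x) => [a /imsetP[i _ ->]|].
  by apply/member_atomP; exists i.
apply/le_anti/andP; split; last first.
  by apply/joinsP => _ /imsetP[i ix ->]; rewrite member_atom_le.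
apply/subsetP => i ix; rewrite -member_atom_le.
by apply: (joins_sup id); apply: imset_f.
Qed.

Definition member_lattice : finAtomicLattice n :=
  @FinAtomicLattice n Order.SetSubsetOrder.subset_display L member_atom
    member_atom_inj member_atomP member_atomic.

End Realization.

(** * The family of sets of an atomic lattice *)

Definition atom_set n (P : finAtomicLattice n) (x : P) : {set 'I_n} :=
  [set i | fal_atom P i <= x].

Definition atom_sets n (P : finAtomicLattice n) : {set {set 'I_n}} :=
  [set atom_set x | x : P].

Definition atom_join n (P : finAtomicLattice n) (A : {set 'I_n}) : P :=
  \join_(i in A) fal_atom P i.

Section AtomSet.
Variables (n : nat) (P : finAtomicLattice n).
Implicit Types (x y : P) (A : {set 'I_n}).

Lemma fal_atom_is_atom i : is_atom (fal_atom P i).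
Proof. by apply/fal_atomP; exists i. Qed.

Lemma fal_atom_gt0 i : \bot < fal_atom P i.
Proof. by case: (fal_atom_is_atom i). Qed.

Lemma fal_atom_le i j : (fal_atom P i <= fal_atom P j) = (i == j).
Proof.
apply/idP/eqP => [lij|->//]; apply/(@fal_atom_inj _ P)/eqP/contraT => neq_ij.
case: (fal_atom_is_atom j) => _ []; exists (fal_atom P i).
by rewrite fal_atom_gt0 lt_neqAle neq_ij.
Qed.

(** Here atomicity enters: [x] is a join of atoms, all of them below [x], so an
    upper bound of the atoms below [x] is an upper bound of [x]. *)
Lemma le_atom_set x y : (x <= y) = (atom_set x \subset atom_set y).
Proof.
apply/idP/subsetP => [lxy i|sxy]; first by rewrite !inE => /le_trans->.
have [->|/fal_atomic[A atA defx]] := eqVneq x \bot; first exact: le0x.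
rewrite defx; apply/joinsP => a aA.
have /fal_atomP[i ai] := atA a aA.
have := sxy i; rewrite !inE ai; apply.
by rewrite defx joins_sup.
Qed.

Lemma atom_set_inj : injective (@atom_set n P).
Proof. by move=> x y eqxy; apply/le_anti; rewrite !le_atom_set eqxy subxx. Qed.

Lemma card_atom_sets : #|atom_sets P| = #|{: P}|.
Proof. by rewrite card_imset //; apply: atom_set_inj. Qed.

Lemma mem_atom_sets x : atom_set x \in atom_sets P.
Proof. exact: imset_f. Qed.

Lemma atom_set0 : atom_set (\bot : P) = set0.
Proof. by apply/setP => i; rewrite !inE lex0 gt_eqF ?fal_atom_gt0. Qed.

Lemma atom_join_le A x : (atom_join P A <= x) = (A \subset atom_set x).
Proof.
apply/joinsP/subsetP => [leA i /leA|sA i /sA]; by rewrite inE.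
Qed.

Lemma sub_atom_join A : A \subset atom_set (atom_join P A).
Proof. by rewrite -atom_join_le. Qed.

Lemma atom_joinK A : A \in atom_sets P -> atom_set (atom_join P A) = A.
Proof.
case/imsetP=> x _ ->; apply/eqP.
by rewrite eqEsubset sub_atom_join andbT -le_atom_set atom_join_le.
Qed.

Lemma closure_system_atom_sets : closure_system (atom_sets P).
Proof.
split=> [||i|_ _ /imsetP[x _ ->] /imsetP[y _ ->]].
- by rewrite -atom_set0 mem_atom_sets.
- have <- : atom_set (\top : P) = setT by apply/setP=> i; rewrite !inE lex1.
  exact: mem_atom_sets.
- have <- : atom_set (fal_atom P i) = [set i].
    by apply/setP=> j; rewrite !inE fal_atom_le.
  exact: mem_atom_sets.
- have <- : atom_set (x `&` y) = atom_set x :&: atom_set y.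
    by apply/setP=> j; rewrite !inE lexI.
  exact: mem_atom_sets.
Qed.

End AtomSet.

Lemma realization n (S : {set {set 'I_n}}) :
  closure_system S -> exists P : finAtomicLattice n, atom_sets P = S.
Proof.
move=> clS; exists (member_lattice clS).
have atom_setE (x : member_lattice clS) : atom_set x = val x.
  by apply/setP=> i; rewrite inE -member_atom_le.
apply/setP=> A; apply/imsetP/idP => [[x _ ->]|AS].
  by rewrite atom_setE (valP x).
by exists (Member clS AS) => //; rewrite atom_setE.
Qed.

(** * Comparing lattices through their families *)

Section Compare.
Variables (n : nat) (P Q : finAtomicLattice n).

(** Given a morphism [f], the join in [P] of the atoms indexed by [atom_set y]
    lies above no further atom, because [f] maps this join below [y].
    Conversely, send [x] to the join in [Q] of the atoms below [x]. This map
    preserves joins: the family of [Q] being included in that of [P], an element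
    of [Q] above the images of [x] and [y] has the same atoms as some element of
    [P], which is then above [x] and [y], hence above their join. *)
Lemma fal_leE : fal_le Q P <-> atom_sets Q \subset atom_sets P.
Proof.
split=> [[f [fU f_atom]]|sQP].
  have f_le x y : x <= y -> f x <= f y.
    by move/join_idPr => <-; rewrite fU leUl.
  apply/subsetP => _ /imsetP[y _ ->].
  have [->|y_neq0] := eqVneq y \bot.
    by rewrite atom_set0; case: (closure_system_atom_sets P).
  (* A join morphism need not preserve the bottom, which is the empty join;  *)
  (* an atom below [y] bounds its image.                                     *)
  have f0_le : f \bot <= y.
    have /set0Pn[j] : atom_set y != set0.
      by rewrite -(atom_set0 Q) (inj_eq (@atom_set_inj _ _)).
    by rewrite inE; apply: le_trans; rewrite -f_atom f_le ?le0x.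
  have fx_le : f (atom_join P (atom_set y)) <= y.
    apply: (big_ind (fun x => f x <= y)) => // [x x' lx lx'|i].
      by rewrite fU leUx lx.
    by rewrite inE f_atom.
  suff <- : atom_set (atom_join P (atom_set y)) = atom_set y.
    exact: mem_atom_sets.
  apply/eqP; rewrite eqEsubset sub_atom_join andbT.
  apply/subsetP=> i; rewrite !inE => /f_le.
  by rewrite f_atom => /le_trans; apply.
exists (fun x => atom_join Q (atom_set x)); split=> [x y|i]; last first.
  rewrite /atom_join (eq_bigl (mem [set i])) ?big_set1 // => j.
  by rewrite !inE fal_atom_le.
set fx := atom_join Q (atom_set x); set fy := atom_join Q (atom_set y).
have /imsetP[z _ defz] := subsetP sQP _ (mem_atom_sets (fx `|` fy)).
apply/le_anti/andP; split.
  rewrite atom_join_le defz -le_atom_set leUx !le_atom_set -defz.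
  by rewrite -!atom_join_le leUl leUr.
rewrite leUx !atom_join_le.
by rewrite !(subset_trans _ (sub_atom_join _ _)) -?le_atom_set ?leUl ?leUr.
Qed.

Lemma fal_isoE : fal_iso Q P <-> atom_sets Q = atom_sets P.
Proof.
split=> [[f [[g gK fK] f_mono f_atom]]|eqQP].
  have atom_set_f x : atom_set (f x) = atom_set x.
    by apply/setP => i; rewrite !inE -f_atom f_mono.
  apply/setP=> A; apply/imsetP/imsetP => -[x _ ->].
    by exists (g x); rewrite // -atom_set_f fK.
  by exists (f x); rewrite ?atom_set_f.
pose f (x : P) := atom_join Q (atom_set x).
have atom_set_f x : atom_set (f x) = atom_set x.
  by rewrite atom_joinK // eqQP mem_atom_sets.
exists f; split=> [|x y|i].
- apply: inj_card_bij => [x y eqf|].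
    by apply/atom_set_inj; rewrite -!atom_set_f eqf.
  by rewrite -!card_atom_sets eqQP.
- by rewrite !le_atom_set !atom_set_f.
- apply/atom_set_inj; rewrite atom_set_f.
  by apply/setP=> j; rewrite !inE !fal_atom_le.
Qed.

Lemma fal_ltE : fal_lt Q P <-> atom_sets Q \proper atom_sets P.
Proof.
rewrite properEneq; split=> [[/fal_leE-> /fal_isoE/eqP->//]|].
by case/andP=> /eqP neqQP /fal_leE leQP; split=> // /fal_isoE.
Qed.

End Compare.

Theorem proposition5p1 (n : nat) (P Q : finAtomicLattice n) (hPQ : fal_le Q P) :
  covers (@fal_lt n) P Q <-> #|{: P}| = #|{: Q}|.+1.
Proof.
rewrite -!card_atom_sets; split=> [[/fal_ltE ltQP noZ]|cardP].
  have [A [AP AQ clA]] := closure_system_setU1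
    (closure_system_atom_sets Q) (closure_system_atom_sets P) ltQP.
  have sAP : A |: atom_sets Q \subset atom_sets P.
    by rewrite subUset sub1set AP proper_sub.
  suff <- : A |: atom_sets Q = atom_sets P by rewrite cardsU1 AQ.
  apply/eqP/contraT => neqAP; case: noZ.
  have [Z defZ] := realization clA; exists Z.
  split; apply/fal_ltE; rewrite defZ; first by rewrite properUr ?sub1set.
  by rewrite properEneq neqAP.
split=> [|[Z [/fal_ltE/proper_card ltQZ /fal_ltE/proper_card]]].
  by apply/fal_ltE; rewrite properEcard cardP ltnSn andbT; apply/fal_leE.
by rewrite cardP ltnS leqNgt ltQZ.
Qed.
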